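(* Suppose $\theta$ is a regular cardinal, $1\le\eta<\theta$, and $\lambda=\theta^{+\eta+1}$. Let $\mathcal{D}$ be a $\theta$-covering matrix for $\lambda$. If $\mathcal{D}$ is transitive and $A_{\mathcal{D}}$ is stationary in $\lambda$, then $\mathcal{D}$ is not normal.
   Context: For regular $\theta<\lambda$, a $\theta$-covering matrix for $\lambda$ is $\mathcal{D}=\langle D(i,\beta)\mid i<\theta,\beta<\lambda\rangle$ with $\beta=\bigcup_{i<\theta}D(i,\beta)$, $D(i,\beta)\subseteq D(j,\beta)$ for $i<j$, and for $\beta<\gamma<\lambda$, $i<\theta$ some $j<\theta$ with $D(i,\beta)\subseteq D(j,\gamma)$. It is transitive if $\alpha\in D(i,\beta)$ implies $D(i,\alpha)\subseteq D(i,\beta)$. It is normal if there is $\beta^*<\lambda$ with $\mathrm{otp}(D(i,\gamma))<\beta^*$ for all $i,\gamma$. When $\theta^+<\lambda$, an ordinal $\beta<\lambda$ of cofinality $>\theta$ is a good point for $\mathcal{D}$ if there is an unbounded $A\subseteq\beta$ such that for every $\gamma<\beta$ there are $\alpha<\beta$ and $i<\theta$ with $A\cap\gamma\subseteq D(i,\alpha)$; $A_{\mathcal{D}}$ is the set of good points for $\mathcal{D}$. *)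

(* Defs.v *)
From mathcomp Require Import all_boot all_order.
From mathcomp Require Import boolp classical_sets functions cardinality.

Set Implicit Arguments.
Unset Strict Implicit.
Unset Printing Implicit Defensive.

Import Order.TTheory.
Local Open Scope order_scope.
Local Open Scope classical_set_scope.

(* Ordinals are the elements of an arbitrary well-ordered type O: a : O stands
   for the order type of its initial segment [below a], which is also the set of
   smaller ordinals, as for von Neumann ordinals. Every notion below mentions
   only initial segments of O, so it does not depend on how long O is. Order
   types, successors, cofinalities and so on are relations rather than
   functions, so that no default value is needed for an ordinal that O is too
   short to contain. *)

Section Ordinals.
Context {d : Order.disp_t} {O : orderType d}.
Implicit Types (a b k m x y : O) (A B C S : set O).

Definition below a : set O := [set x | x < a].

Definition is_zero a := forall x, a <= x.

Definition is_succ a b := a < b /\ forall x, a < x -> b <= x.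

Definition is_one a := exists2 z, is_zero z & is_succ z a.

Definition is_limit a :=
  (exists x, x < a) /\ forall x, x < a -> exists2 y, x < y & y < a.

Definition is_otp A a := exists f : O -> O,
  set_bij A (below a) f /\
  forall x y, A x -> A y -> x < y -> f x < f y.

Definition unbounded_in A b := forall x, x < b -> exists2 y, (A `&` below b) y & x <= y.

Definition is_cof b m :=
  (exists A, [/\ A `<=` below b, unbounded_in A b & is_otp A m]) /\
  forall B n, B `<=` below b -> unbounded_in B b -> is_otp B n -> m <= n.

Definition is_cardinal k := forall a, a < k -> ~ (below a #= below k)%card.

Definition is_regular k :=
  [/\ is_cardinal k, infinite_set (below k) & is_cof k k].

Definition is_card_succ k m :=
  [/\ is_cardinal m, k < m & forall n, is_cardinal n -> k < n -> m <= n].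

(* [card_plus k x m] : m = k^{+x}, by transfinite recursion on x. *)
Inductive card_plus k : O -> O -> Prop :=
| card_plus_zero x : is_zero x -> card_plus k x k
| card_plus_succ x y m n :
    is_succ x y -> card_plus k x m -> is_card_succ m n -> card_plus k y n
| card_plus_limit x (f : O -> O) m :
    is_limit x -> (forall y, y < x -> card_plus k y (f y)) ->
    supremums (f @` below x) m -> card_plus k x m.

Definition is_club C l :=
  [/\ C `<=` below l, unbounded_in C l &
      forall a, a < l -> is_limit a -> unbounded_in C a -> C a].

Definition is_stationary S l :=
  S `<=` below l /\ forall C, is_club C l -> S `&` C !=set0.

(* A matrix is given by D : O -> O -> set O; only the entries D i b with
   i < theta and b < lambda are meaningful. *)
Definition covering_matrix theta lambda (D : O -> O -> set O) :=
  [/\ forall b, b < lambda -> below b = \bigcup_(i in below theta) D i b,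
      forall i j b, i < j -> j < theta -> b < lambda -> D i b `<=` D j b &
      forall b c i, b < c -> c < lambda -> i < theta ->
        exists2 j, j < theta & D i b `<=` D j c].

Definition matrix_transitive theta lambda (D : O -> O -> set O) :=
  forall i a b, i < theta -> b < lambda -> D i b a -> D i a `<=` D i b.

Definition matrix_normal theta lambda (D : O -> O -> set O) :=
  exists2 bstar, bstar < lambda &
    forall i c, i < theta -> c < lambda ->
      exists2 a, is_otp (D i c) a & a < bstar.

Definition good_point theta lambda (D : O -> O -> set O) b :=
  [/\ b < lambda,
      exists2 m, is_cof b m & theta < m &
      exists A, [/\ A `<=` below b, unbounded_in A b &
        forall c, c < b -> exists a i,
          [/\ a < b, i < theta & A `&` below c `<=` D i a]]].

Definition good_points theta lambda (D : O -> O -> set O) : set O :=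
  [set b | good_point theta lambda D b].

End Ordinals.

(* Main.v *)
(* Suppose D is normal and let f_a(i) < bstar be the order type of D(i, a).
   Transitivity makes (f_a | a < lambda) increasing modulo bounded subsets of
   theta. At a good point b, and hence by pressing down for all large a, the
   least element of S(i) above f_a(i) does not depend on a (modulo bounded sets)
   whenever every S(i) has size at most theta. On the other hand no function h
   is a least upper bound of the f_a: for the i with cf(h(i)) <= theta use the
   previous remark with S(i) cofinal in h(i); the remaining i fall into fewer
   than theta classes cf(h(i)) = theta^{+xi}, and since cf(h(i)) < lambda a
   single element of the cofinality serves all a. Iterating both facts theta^+
   times, S(i) being the set of the earlier bounds at i, gives theta^+ many
   upper bounds; infinitely many of them strictly decrease at one index i. *)

Require Import Defs.
From mathcomp Require Import all_boot all_order.
From mathcomp Require Import boolp classical_sets functions cardinality.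

Set Implicit Arguments.
Unset Strict Implicit.
Unset Printing Implicit Defensive.

Import Order.TTheory.
Local Open Scope order_scope.
Local Open Scope classical_set_scope.
Local Open Scope card_scope.

(** * Choice and well-founded recursion *)

Lemma choice_in T U (u0 : U) (A : set T) (P : T -> U -> Prop) :
  (forall x, A x -> exists u, P x u) ->
  exists f : T -> U, forall x, A x -> P x (f x).
Proof.
move=> AP; suff /choice[f fP] : forall x, exists u, A x -> P x u by exists f.
move=> x.
by have [/AP[u]|nAx] := pselect (A x); [exists u|exists u0].
Qed.

(** A choice function applied to [F] truncated to the predecessors of [x] (value [u0] elsewhere)
    drives the recursion; [P_ext] moves between [F] and its truncation. *)
Lemma wf_choice_rec T U (R : T -> T -> Prop) (u0 : U)
    (P : T -> (T -> U) -> U -> Prop) :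
  well_founded R ->
  (forall x F G u, (forall y, R y x -> F y = G y) -> P x F u -> P x G u) ->
  (forall x F, (forall y, R y x -> P y F (F y)) -> exists u, P x F u) ->
  exists F, forall x, P x F (F x).
Proof.
move=> wfR P_ext P_ex.
pose ext x (rec : forall y, R y x -> U) y :=
  if pselect (R y x) is left Ryx then rec y Ryx else u0.
have [c cP] : exists c : T -> (T -> U) -> U,
    forall x F, (exists u, P x F u) -> P x F (c x F).
  have [c cP] := @choice_in (T * (T -> U)) U u0
    [set p | exists u, P p.1 p.2 u] (fun p u => P p.1 p.2 u) (fun p h => h).
  by exists (fun x F => c (x, F)) => x F /(cP (x, F)).
pose step x (rec : forall y, R y x -> U) := c x (ext x rec).
pose F := Fix wfR (fun=> U) step.
have FE x : F x = c x (ext x (fun y _ => F y)).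
  rewrite /F Fix_eq // => y f g fg; rewrite /step; congr (c y _).
  by apply/funext => z; rewrite /ext; case: pselect.
exists F; apply: (well_founded_ind wfR) => x IH.
have extF y : R y x -> F y = ext x (fun y _ => F y) y.
  by rewrite /ext; case: pselect.
have [u Pu] := P_ex x F IH.
rewrite FE; apply: (P_ext _ (ext x (fun y _ => F y))) => [y Ryx|].
  by rewrite -extF.
by apply: cP; exists u; apply: P_ext Pu.
Qed.

(** * Comparison of cardinalities *)

Lemma inj_into_card_le T U (A : set T) (B : set U) (f : T -> U) :
  (forall x, A x -> B (f x)) ->
  (forall x y, A x -> A y -> f x = f y -> x = y) -> A #<= B.
Proof.
move=> fAB f_inj.
have /card_eqPle[_ Af] : f @` A #= A.
  by apply: inj_card_eq => x y /set_mem Ax /set_mem Ay; apply: f_inj.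
by apply: card_le_trans Af _; apply: subset_card_le => _ [x Ax <-]; apply: fAB.
Qed.

Lemma surj_onto_card_le T U (A : set T) (B : set U) (f : U -> T) :
  (forall x, A x -> exists2 y, B y & f y = x) -> A #<= B.
Proof.
move=> fBA; apply: card_le_trans (card_image_le f B).
by apply: subset_card_le => x /fBA[y By <-]; exists y.
Qed.

Lemma card_le_inj_into T U (u0 : U) (A : set T) (B : set U) : A #<= B ->
  exists2 f : T -> U, forall x, A x -> B (f x) &
    forall x y, A x -> A y -> f x = f y -> x = y.
Proof.
elim/Ppointed: U u0 B => [U u0|U u0 B]; first by case: (no u0).
move=> /pcard_leP[f]; exists f => [x Ax|x y Ax Ay]; first exact: funS.
by apply: inj; rewrite inE.
Qed.

(** Hilbert's hotel: for a sequence [e] injected into [A], a new point [x] goes to [e 0], [e n] goes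
    to [e n.+1], and all else stays fixed. *)
Lemma infinite_card_le_setU1 T (A : set T) (x : T) :
  infinite_set A -> x |` A #<= A.
Proof.
move=> /infiniteP/(card_le_inj_into x)[e eA e_inj].
have [Ax|nAx] := pselect (A x).
  by apply: subset_card_le => y [->|].
have [s sP] : exists s : T -> T, forall y, (forall n, y = e n -> s y = e n.+1) /\
    ((forall n, y <> e n) -> s y = if pselect (y = x) then e 0%N else y).
  suff /choice[s sP] : forall y, exists z, (forall n, y = e n -> z = e n.+1) /\
      ((forall n, y <> e n) -> z = if pselect (y = x) then e 0%N else y).
    by exists s.
  move=> y.
  have [[n ->]|ny] := pselect (exists n, y = e n).
    exists (e n.+1); split=> [m /e_inj-> //|/(_ n)//].
  exists (if pselect (y = x) then e 0%N else y); split=> // n yn.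
  by case: ny; exists n.
have sx : s x = e 0%N.
  rewrite (sP x).2; first by case: pselect.
  by move=> n xn; apply: nAx; rewrite xn; apply: eA.
have sE y : A y -> (exists2 n, y = e n & s y = e n.+1) \/
                   (forall n, y <> e n) /\ s y = y.
  move=> Ay; have [[n yn]|ny] := pselect (exists n, y = e n).
    by left; exists n => //; apply: (sP y).1.
  right; have ny' n : y <> e n by move=> yn; apply: ny; exists n.
  split=> //; rewrite (sP y).2 //; case: pselect => // yx.
  by case: nAx; rewrite -yx.
apply: (inj_into_card_le (f := s)).
  move=> y [->|Ay]; first by rewrite sx; apply: eA.
  by have [[n _ ->]|[_ ->]//] := sE y Ay; apply: eA.
move=> y z [->|Ay] [->|Az] //.
- by rewrite sx; have [[n zn ->]|[nz ->]] := sE z Az => [/e_inj|/esym/nz]; [move=> /(_ I I)|].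
- by rewrite sx; have [[n zn ->]|[nz ->]] := sE y Ay => [/e_inj|/nz]; [move=> /(_ I I)|].
have [[n -> ->]|[ny ->]] := sE y Ay; have [[m -> ->]|[nz ->]] := sE z Az => //.
- by move=> /e_inj => /(_ I I) [->].
- by move=> /esym/nz.
- by move/ny.
Qed.

(** * Cardinals, order types and cofinalities in a well-order *)

Section WellOrder.
Context {d : Order.disp_t} {O : orderType d}.
Context (wfO : well_founded (fun x y : O => x < y)).
Implicit Types (a b c k m n t x y z : O) (A B X : set O) (v w : O -> O).

Lemma wf_min A x : A x -> exists2 m, A m & forall y, A y -> m <= y.
Proof.
elim/(well_founded_ind wfO): x => x IH Ax.
have [[y yx Ay]|nAy] := pselect (exists2 y, y < x & A y); first exact: IH Ay.
by exists x => // y Ay; rewrite leNgt; apply/negP => yx; apply: nAy; exists y.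
Qed.

Lemma card_le_below a b : a <= b -> below a #<= below b.
Proof. by move=> ab; apply: subset_card_le => x /= /lt_le_trans; apply. Qed.

Lemma cardinal_not_card_le k a : is_cardinal k -> a < k -> ~ (below k #<= below a).
Proof.
move=> kC ak ka; apply: (kC a ak); apply/card_eqPle; split=> //.
exact/card_le_below/ltW.
Qed.

Lemma infinite_cardinal_limit k x : is_cardinal k -> infinite_set (below k) ->
  x < k -> exists2 y, x < y & y < k.
Proof.
move=> kC k_inf xk; apply: contrapT => no_y.
have kE : below k `<=` x |` below x.
  move=> y /= yk; have [xy|//|->] := ltgtP x y; [|by right|by left].
  by case: no_y; exists y.
apply: (cardinal_not_card_le kC xk).
apply: card_le_trans (subset_card_le kE) _.
apply: infinite_card_le_setU1 => x_fin; apply: k_inf.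
by apply: sub_finite_set kE _; rewrite finite_setU; split=> //; apply: finite_set1.
Qed.

Lemma cardinal_of a : exists k, [/\ is_cardinal k, k <= a & below k #= below a].
Proof.
have [k /= ka k_min] :=
  @wf_min [set k | below k #= below a] a (card_eqxx (below a)).
exists k; split=> //; last exact: (k_min a (card_eqxx (below a))).
move=> b bk bkE; have := k_min b (card_eq_trans bkE ka).
by rewrite leNgt bk.
Qed.

Lemma card_succ_card_le k m a : is_card_succ k m -> a < m -> below a #<= below k.
Proof.
move=> [_ _ m_min] am; have [n [nC na /card_eqPle[_ an]]] := cardinal_of a.
apply: card_le_trans an _; apply: card_le_below; rewrite leNgt; apply/negP => kn.
by have := m_min n nC kn; rewrite leNgt (le_lt_trans na am).
Qed.

(** Gödel's well-order of pairs: by maximum first, then lexicographically. *)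
Let godel (p q : O * O) :=
  Order.max p.1 p.2 < Order.max q.1 q.2 \/
  Order.max p.1 p.2 = Order.max q.1 q.2 /\
  (p.1 < q.1 \/ p.1 = q.1 /\ p.2 < q.2).

Let wf_godel : well_founded godel.
Proof.
suff H m x y : Order.max x y = m -> Acc godel (x, y) by case=> x y; apply: H.
elim/(well_founded_ind wfO): m x y => m IHm x.
elim/(well_founded_ind wfO): x => x IHx y.
elim/(well_founded_ind wfO): y => y IHy mE.
constructor=> -[x' y']; rewrite /godel /= mE => -[lt_m|[mE' [lt_x|[xE lt_y]]]].
- exact: IHm lt_m _ _ erefl.
- exact: IHx.
- by rewrite xE; apply: IHy => //; rewrite -xE.
Qed.

Let godel_total p q : p <> q -> godel p q \/ godel q p.
Proof.
case: p q => x y [x' y'] pq; rewrite /godel /=.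
have [?|?|mE] := ltgtP (Order.max x y) (Order.max x' y'); [by left; left|by right; left|].
have [?|?|xE] := ltgtP x x'; [by left; right; split=> //; left|
  by right; right; split=> //; left|].
have [?|?|yE] := ltgtP y y'; [by left; right; split=> //; right|
  by right; right; split=> //; right|].
by case: pq; rewrite xE yE.
Qed.

(** Induction on [a], passing to its cardinality if [a] is not a cardinal. Otherwise pairs receive
    distinct values below [a] by recursion along [godel]: the predecessors of a pair lie in a
    smaller square, which by induction cannot exhaust [below a]. *)
Lemma infinite_card_square a : infinite_set (below a) ->
  below a `*` below a #<= below a.
Proof.
elim/(well_founded_ind wfO): a => a IH a_inf.
have [k [kC + ka]] := cardinal_of a; rewrite le_eqVlt => /orP[/eqP kE|lt_ka]; last first.
  have k_inf : infinite_set (below k) by rewrite (eq_finite_set ka).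
  have /card_eqPle[ka' ak] := ka.
  apply: card_le_trans ka'; apply: card_le_trans (IH k lt_ka k_inf).
  have [f fk f_inj] := card_le_inj_into a ak.
  apply: (inj_into_card_le (f := fun p => (f p.1, f p.2))).
    by move=> [x y] /= [/fk ? /fk].
  move=> [x y] [x' y'] /= [xa ya] [x'a y'a] [/f_inj-> //].
  by move/f_inj => ->.
have {kE kC}aC : is_cardinal a by rewrite -kE.
pose sq : set (O * O) := below a `*` below a.
have [F FP] : exists F, forall p, sq p ->
    F p < a /\ forall q, sq q -> godel q p -> F q <> F p.
  apply: (@wf_choice_rec _ _ _ a (fun p F u => sq p ->
    u < a /\ forall q, sq q -> godel q p -> F q <> u) wf_godel).
    move=> p F G u FG Pu sqp; have [ua uF] := Pu sqp; split=> // q sqq qp.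
    by rewrite -FG //; apply: uF.
  move=> p F _; have [sqp|nsqp] := pselect (sq p); last by exists a.
  apply: contrapT => no_u.
  pose m := Order.max p.1 p.2.
  have ma : m < a by rewrite gt_max; apply/andP.
  (* A point strictly above [m] turns the weak bound [m] on the maxima of predecessors into
     membership in the square of [below m']. *)
  have [m' mm' m'a] := infinite_cardinal_limit aC a_inf ma.
  pose seg := below m' `*` below m'.
  have sub_seg : below a #<= seg.
    apply: (surj_onto_card_le (f := F)) => u ua; apply: contrapT => no_q.
    apply: no_u; exists u => _; split=> // q sqq qp uE; apply: no_q.
    exists q => //.
    have : Order.max q.1 q.2 <= m.
      by case: qp => [/ltW|[->]].
    rewrite ge_max => /andP[q1 q2].
    by split; apply: le_lt_trans mm'.
  have [m'_fin|m'_inf] := pselect (finite_set (below m')).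
    by apply: a_inf; apply: card_le_finite sub_seg _; apply: finite_setX.
  apply: (cardinal_not_card_le aC m'a).
  exact: card_le_trans sub_seg (IH m' m'a m'_inf).
apply: (inj_into_card_le (f := F)) => [p /FP[]//|p q sqp sqq Fpq].
have [_ Fp] := FP p sqp; have [_ Fq] := FP q sqq.
apply: contrapT => pq; have [|] := godel_total pq.
  by move=> /(Fq _ sqp).
by move=> /(Fp _ sqq); rewrite Fpq.
Qed.

(** Regularity of successor cardinals: if [v] were unbounded, each [y < m] could be coded by an
    index [t] with [y < v t] and the image of [y] under an injection of [v t] into [k], so [m] would
    inject into the square of [k]. *)
Lemma card_succ_bounded k m c v : is_card_succ k m -> infinite_set (below k) ->
  c < m -> (forall t, t < c -> v t < m) ->
  exists2 y, y < m & forall t, t < c -> v t <= y.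
Proof.
move=> km k_inf cm vm; apply: contrapT => no_y.
have [mC lt_km _] := km.
have /(choice_in k)[r rP] : forall y, below m y -> exists t, t < c /\ y < v t.
  move=> y ym; apply: contrapT => no_t.
  apply: no_y; exists y => // t tc; rewrite leNgt; apply/negP => yt.
  by apply: no_t; exists t.
have [e ek e_inj] := card_le_inj_into k (card_succ_card_le km cm).
have /(choice_in id)[g gP] : forall t, below c t -> exists g : O -> O,
    (forall y, y < v t -> g y < k) /\
    forall y z, y < v t -> z < v t -> g y = g z -> y = z.
  move=> t /vm vt.
  by have [g gk g_inj] := card_le_inj_into k (card_succ_card_le km vt); exists g.
apply: (cardinal_not_card_le mC lt_km).
apply: card_le_trans (infinite_card_square k_inf).
apply: (inj_into_card_le (f := fun y => (e (r y), g (r y) y))).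
  by move=> y /rP[rc yr]; split; [apply: ek|apply: (gP _ rc).1].
move=> y z /rP[yc yr] /rP[zc zr] [/e_inj] => /(_ yc zc) rE.
by rewrite rE in yr *; apply: (gP _ zc).2.
Qed.

(* The Mostowski collapse of [X]; it lies below [w] pointwise. *)
Lemma is_otp_exists X w c : (forall x, X x -> w x < c) ->
  (forall x y, X x -> X y -> x < y -> w x < w y) ->
  exists2 n, n <= c & is_otp X n.
Proof.
move=> wc w_incr.
pose ub x (F : O -> O) u := forall y, X y -> y < x -> F y < u.
have [F FP] : exists F : O -> O, forall x, X x ->
    [/\ ub x F (F x), forall z, ub x F z -> F x <= z & F x <= w x].
  apply: (@wf_choice_rec _ _ _ c (fun x F u => X x ->
    [/\ ub x F u, forall z, ub x F z -> u <= z & u <= w x]) wfO).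
    move=> x F G u FG Pu /Pu[ubF uF uw].
    have ubE z : ub x F z <-> ub x G z.
      by split=> ubz y Xy yx; [rewrite -FG|rewrite FG]; do ?apply: ubz.
    by split=> // [|z /ubE/uF//]; apply/ubE.
  move=> x F IH; have [Xx|nXx] := pselect (X x); last by exists c.
  have ubw : ub x F (w x).
    by move=> y Xy yx; have [_ _ /le_lt_trans] := IH y yx Xy; apply; apply: w_incr.
  have [u ubu u_min] := wf_min ubw.
  by exists u => _; split=> //; apply: u_min.
have F_incr x y : X x -> X y -> x < y -> F x < F y.
  by move=> Xx Xy xy; have [/(_ x Xx xy)] := FP y Xy.
have c_out : ~ (F @` X) c.
  move=> [x Xx Fx]; have [_ _] := FP x Xx; rewrite Fx leNgt.
  by rewrite wc.
have [n n_out n_min] := @wf_min (~` (F @` X)) c c_out.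
exists n; first exact: n_min.
exists F; split=> //; split.
- move=> x Xx; rewrite /below /= ltNge; apply/negP => nF.
  have [x' [Xx' nF'] x'_min] := @wf_min [set x | X x /\ n <= F x] x (conj Xx nF).
  have nF'' : n < F x'.
    by rewrite lt_neqAle nF' andbT; apply/eqP => nE; apply: n_out; exists x'.
  have [_ F_min _] := FP x' Xx'.
  have := F_min n; rewrite leNgt nF'' => /(_ _)/negP; apply => // y Xy yx'.
  by rewrite ltNge; apply/negP => nFy; have := x'_min y (conj Xy nFy); rewrite leNgt yx'.
- move=> x y /set_mem Xx /set_mem Xy Fxy; have [xy|yx|//] := ltgtP x y.
    by have := F_incr x y Xx Xy xy; rewrite Fxy ltxx.
  by have := F_incr y x Xy Xx yx; rewrite Fxy ltxx.
- move=> u /= un; apply: contrapT => u_out.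
  by have := n_min u u_out; rewrite leNgt un.
Qed.

(** Cofinality constrains only sets, through their order types. Restricting [v] to its record
    indices, where it exceeds all earlier values, makes it increasing and keeps it unbounded, so its
    range would have type at most [c]. *)
Lemma is_cof_bounded b m c v : is_cof b m -> c < m ->
  (forall t, t < c -> v t < b) -> exists2 y, y < b & forall t, t < c -> v t < y.
Proof.
move=> [_ m_min] cm vb; apply: contrapT => no_y.
pose rec t := t < c /\ forall s, s < t -> v s < v t.
have rec_incr s t : rec s -> rec t -> v s < v t -> s < t.
  move=> [_ sR] _; rewrite !ltNge; apply: contra; rewrite le_eqVlt => /orP[/eqP->//|ts].
  exact/ltW/sR.
have rec_unb y : y < b -> exists2 t, rec t & y <= v t.
  move=> yb; have [t [tc yt]] : exists t, t < c /\ y <= v t.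
    apply: contrapT => no_t; apply: no_y; exists y => // t tc.
    by rewrite ltNge; apply/negP => yt; apply: no_t; exists t.
  have [s [sc ys] s_min] := @wf_min [set t | t < c /\ y <= v t] t (conj tc yt).
  exists s => //; split=> // r rs; apply: lt_le_trans ys.
  rewrite ltNge; apply/negP => yr.
  by have := s_min r (conj (lt_trans rs sc) yr); rewrite leNgt rs.
have /(choice_in b)[w wP] : forall x, (v @` rec) x -> exists t, rec t /\ v t = x.
  by move=> x [t rt <-]; exists t.
have [n nc otp_n] : exists2 n, n <= c & is_otp (v @` rec) n.
  apply: (@is_otp_exists _ w) => [x /wP[[]]//|x y /wP[rx xE] /wP[ry yE] xy].
  by apply: rec_incr => //; rewrite xE yE.
have := m_min (v @` rec) n _ _ otp_n; rewrite leNgt (le_lt_trans nc cm) => H.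
suff: false by []; apply: H.
  by move=> _ [t [tc _] <-]; apply: vb.
move=> y /rec_unb[t rt yt]; exists (v t) => //; split; first by exists t.
by case: rt => /vb.
Qed.

(** If [g x < a], the element of [A] in position [g x] would be sent by [g] to at least [g x],
    although it precedes [x]. *)
Lemma is_otp_lt A B a b x :
  is_otp A a -> is_otp B b -> A `<=` B -> A `<=` below x -> B x -> a < b.
Proof.
move=> [f [[_ _ f_surj] f_incr]] [g [[g_fun _ _] g_incr]] AB Ax Bx.
apply: le_lt_trans (g_fun x Bx); rewrite leNgt; apply/negP => gxa.
have /(choice_in x)[r rP] : forall y, below a y -> exists z, A z /\ f z = y.
  by move=> y /f_surj[z Az <-]; exists z.
have r_incr y z : y < z -> z < a -> r y < r z.
  move=> yz za; have [Ay fy] := rP y (lt_trans yz za); have [Az fz] := rP z za.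
  have [//|ryz|ryz] := ltgtP (r y) (r z).
    by have := f_incr _ _ Az Ay ryz; rewrite fy fz ltNge ltW.
  by move: yz; rewrite -fy -fz ryz ltxx.
(* [g \o r] is strictly increasing below [a], hence expansive. *)
have gr_ge y : y < a -> y <= g (r y).
  elim/(well_founded_ind wfO): y => y IH ya; rewrite leNgt; apply/negP => gy.
  have gya := lt_trans gy ya; have := IH _ gy gya.
  rewrite leNgt => /negP; apply; apply: g_incr; last exact: r_incr.
    exact/AB/(rP _ gya).1.
  exact/AB/(rP _ ya).1.
have := gr_ge _ gxa; rewrite leNgt => /negP; apply.
have [Ar _] := rP _ gxa; exact: g_incr (AB _ Ar) Bx (Ax _ Ar).
Qed.

End WellOrder.

(** * Successor cardinals: pigeonhole, pressing down, cofinal maps *)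

Section SuccessorCardinal.
Context {d : Order.disp_t} {O : orderType d}.
Context (wfO : well_founded (fun x y : O => x < y)).
Implicit Types (a b c k m n t x y z : O) (A B X : set O) (v w : O -> O).

Lemma card_succ_limit k m x : is_card_succ k m -> infinite_set (below k) ->
  x < m -> exists2 y, x < y & y < m.
Proof.
move=> [mC km _] k_inf; apply: infinite_cardinal_limit => //.
by apply: sub_infinite_set k_inf => z /= /lt_trans; apply.
Qed.

(** Otherwise each [j] is avoided from some [b j] on; by regularity of [m] these points have a
    common bound [y < m], and then [v y] is avoided at [y] itself. *)
Lemma card_succ_pigeonhole k m c v : is_card_succ k m -> infinite_set (below k) ->
  c < m -> (forall x, x < m -> v x < c) ->
  exists2 j, j < c & forall b, b < m -> exists x, [/\ b <= x, x < m & v x = j].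
Proof.
move=> km k_inf cm vc; apply: contrapT => no_j.
have /(choice_in k)[b bP] : forall j, below c j -> exists b, b < m /\
    forall x, b <= x -> x < m -> v x <> j.
  move=> j jc; apply: contrapT => no_b; apply: no_j; exists j => // b bm.
  apply: contrapT => no_x; apply: no_b; exists b; split=> // x bx xm xj.
  by apply: no_x; exists x.
have [|y ym by_] := @card_succ_bounded _ _ wfO k m c b km k_inf cm.
  by move=> t /bP[].
have yc := vc y ym; have [_ /(_ y (by_ _ yc) ym)] := bP _ yc.
exact.
Qed.

Lemma card_succ_nat_bounded k m (u : nat -> O) : is_card_succ k m ->
  infinite_set (below k) -> (forall j, u j < m) ->
  exists2 y, y < m & forall j, u j <= y.
Proof.
move=> km k_inf um; have [_ lt_km _] := km.
have /infiniteP/(card_le_inj_into k)[e ek e_inj] := k_inf.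
have /(choice_in 0%N)[r rP] : forall t, range e t -> exists j, e j = t.
  by move=> t [j _ <-]; exists j.
have [y ym uy] := @card_succ_bounded _ _ wfO k m k (u \o r) km k_inf lt_km
  (fun t _ => um (r t)).
exists y => // j; have := uy (e j) (ek j I) => /=.
by rewrite (e_inj (r (e j)) j) // rP //; exists j.
Qed.

(* A weak form of Fodor's lemma: [C] below is the club of closure points of a
   would-be counterexample. *)
Lemma stationary_pressing_down k m S (Q : O -> O -> Prop) :
  is_card_succ k m -> infinite_set (below k) -> is_stationary S m ->
  (forall x, S x -> exists2 a, a < x & Q a x) ->
  exists2 a, a < m & forall b, b < m -> exists x, [/\ b <= x, x < m & Q a x].
Proof.
move=> km k_inf [Sm S_stat] SQ; apply: contrapT => no_a.
have /(choice_in k)[g gP] : forall a, below m a -> exists b, b < m /\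
    forall x, b <= x -> x < m -> ~ Q a x.
  move=> a am; apply: contrapT => no_b; apply: no_a; exists a => // b bm.
  apply: contrapT => no_x; apply: no_b; exists b; split=> // x bx xm Qx.
  by apply: no_x; exists x.
pose C := [set x | x < m /\ forall a, a < x -> g a < x].
have /(choice_in k)[step stepP] : forall y, below m y -> exists z,
    [/\ y < z, z < m & forall a, a < y -> g a < z].
  move=> y ym; have [|b bm gb] := @card_succ_bounded _ _ wfO k m y g km k_inf ym.
    by move=> t ty; have [] := gP t (lt_trans ty ym).
  have bym : Order.max b y < m by rewrite gt_max bm.
  have [z] := card_succ_limit km k_inf bym; rewrite gt_max => /andP[bz yz] zm.
  by exists z; split=> // a /gb /le_lt_trans; apply.
have [x [Sx [xm xC]]] : S `&` C !=set0.
  apply: S_stat; split=> [x []//|x xm|a am a_lim C_unb].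
    (* The supremum of the iterates of [step] is a closure point of [g]. *)
    pose u j := iter j step x.
    have um j : u j < m by elim: j => // j /stepP[].
    have [y ym uy] := card_succ_nat_bounded km k_inf um.
    have [z uz z_min] := @wf_min _ _ wfO [set z | forall j, u j <= z] y uy.
    have zm : z < m := le_lt_trans (z_min y uy) ym.
    exists z; last exact: (uz 0%N).
    split=> //; split=> // a az; have [j aj] : exists j, a < u j.
      apply: contrapT => no_j; have : z <= a.
        by apply: z_min => j; rewrite leNgt; apply/negP => aj; apply: no_j; exists j.
      by rewrite leNgt az.
    have [_ _ /(_ a aj) ga] := stepP _ (um j).
    exact: lt_le_trans ga (uz j.+1).
  split=> // b ba; have [c bc ca] := a_lim.2 b ba.
  have [y [[_ yC] ya] cy] := C_unb c ca.
  exact: lt_trans (yC b (lt_le_trans bc cy)) ya.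
have [a ax Qax] := SQ x Sx.
have [_ /(_ x (ltW (xC a ax)) xm)] := gP a (lt_trans ax xm).
exact.
Qed.

(** Here [k] is the least length of a map with cofinal range in [x], that is, the cofinality of [x]
    without order types. The last clause says that [k] itself has cofinality above [theta]: a
    [theta]-sequence cofinal in [k] would, composed with [H], be cofinal in [x]. *)
Lemma cofinality_cases theta x : infinite_set (below theta) ->
  (exists u, forall y, y < x -> exists t, [/\ t < theta, y <= u t & u t < x]) \/
  exists k H, [/\ is_cardinal k, theta < k <= x,
    forall a b, a <= b -> b < k -> H a <= H b,
    forall y, y < x -> exists2 a, a < k & y <= H a &
    (forall a, a < k -> H a < x) /\
    forall v, (forall t, t < theta -> v t < k) ->
      exists2 a, a < k & forall t, t < theta -> v t <= a].
Proof.
move=> th_inf; pose cofinal k u := (forall a, a < k -> u a < x) /\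
  forall y, y < x -> exists2 a, a < k & y <= u a.
have [k [u [ux u_cof]] k_min] : exists2 k, (exists u, cofinal k u) &
    forall n, (exists u, cofinal n u) -> k <= n.
  by apply: (@wf_min _ _ wfO _ x); exists id; split=> // y yx; exists y.
have [k_th|th_k] := leP k theta.
  left; exists u => y /u_cof[a ak ya]; exists a; split=> //; last exact: ux.
  exact: lt_le_trans k_th.
have no_cof n w : n < k -> ~ cofinal n w.
  by move=> nk w_cof; have := k_min n (ex_intro _ w w_cof); rewrite leNgt nk.
right.
have kC : is_cardinal k.
  move=> n nk /card_eqPle[_ /(card_le_inj_into k)[e en e_inj]].
  have /choice[p pP] : forall t, exists a, a < k /\
      forall b, b < k -> e b = t -> a = b.
    move=> t; have [[a ak <-]|no_a] := pselect (exists2 a, a < k & e a = t).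
      by exists a; split=> // b bk /e_inj -> .
    by exists n; split=> // b bk bt; case: no_a; exists b.
  apply: (no_cof n (u \o p) nk); split=> [a an|y /u_cof[a ak ya]].
    exact/ux/(pP a).1.
  by exists (e a); [apply: en|rewrite /= ((pP (e a)).2 a)].
(* [H a] is the least strict upper bound of the [u b] with [b < a], which makes [H] monotone; it
   lies below [x] because [a < k]. *)
have /(choice_in k)[H HP] : forall a, below k a -> exists y,
    [/\ y < x, forall b, b < a -> u b < y &
        forall z, z < x -> (forall b, b < a -> u b < z) -> y <= z].
  move=> a ak; have [y [yx ay]] : exists y, y < x /\ forall b, b < a -> u b < y.
    apply: contrapT => no_y; apply: (no_cof a u ak); split=> [b ba|y yx].
      exact/ux/(lt_trans ba).
    apply: contrapT => no_b; apply: no_y; exists y; split=> // b ba.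
    by rewrite ltNge; apply/negP => yb; apply: no_b; exists b.
  have [z [zx az] z_min] :=
    @wf_min _ _ wfO [set y | y < x /\ forall b, b < a -> u b < y] y (conj yx ay).
  by exists z; split=> // y' ? ?; apply: z_min.
have k_inf : infinite_set (below k).
  by apply: sub_infinite_set th_inf => z /= /lt_trans; apply.
have H_homo a b : a <= b -> b < k -> H a <= H b.
  move=> ab bk; have [Hbx ubH _] := HP b bk.
  have [_ _ Ha_min] := HP a (le_lt_trans ab bk).
  by apply: Ha_min => // c ca; apply/ubH/(lt_le_trans ca).
have H_cof y : y < x -> exists2 a, a < k & y <= H a.
  move=> /u_cof[a ak ya]; have [b ab bk] := infinite_cardinal_limit kC k_inf ak.
  exists b => //; have [_ /(_ a ab) uH _] := HP b bk.
  exact/ltW/(le_lt_trans ya).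
have Hx a : a < k -> H a < x by move=> /HP[].
exists k, H; split=> //.
  by rewrite th_k; apply: k_min; exists id; split=> // z zx; exists z.
split=> // v vk; apply: contrapT => no_a; apply: (no_cof theta (H \o v) th_k).
split=> [t /vk/Hx//|y /H_cof[a ak ya]]; apply: contrapT => no_t.
apply: no_a; exists a => // t tth; rewrite leNgt; apply/negP => at_.
apply: no_t; exists t => //; apply: le_trans ya _.
by apply: H_homo; [apply: ltW|apply: vk].
Qed.

End SuccessorCardinal.

(** * Bounded sequences increasing modulo bounded subsets of [theta] *)

Section IncreasingSequence.
Context {d : Order.disp_t} {O : orderType d}.
Context (wfO : well_founded (fun x y : O => x < y)).
Implicit Types (a b c k m n t x y z : O) (A B X : set O) (v w : O -> O).

Context (theta mu lambda bstar : O) (f : O -> O -> O) (S : set O).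
Context (theta_regular : is_regular theta) (theta_le_mu : theta <= mu).
Context (lambda_succ : is_card_succ mu lambda) (bstar_lt : bstar < lambda).

Definition eventually (P : O -> Prop) :=
  exists2 k, k < theta & forall i, k <= i -> i < theta -> P i.

Context (f_lt : forall a i, a < lambda -> i < theta -> f a i < bstar).
Context (f_incr : forall a b, a < b -> b < lambda ->
  eventually (fun i => f a i < f b i)).
Context (S_stationary : is_stationary S lambda).
(** Goodness as seen by order types: inclusion in a matrix entry becomes eventual domination by a
    single [f a]. *)
Context (S_good : forall b, S b ->
  (exists2 m, is_cof b m & theta < m) /\
  exists A, unbounded_in A b /\ forall c, c < b ->
    exists2 a, a < b & eventually (fun i => forall x, A x -> x < c -> f x i <= f a i)).

Let theta_infinite : infinite_set (below theta).
Proof. by case: theta_regular. Qed.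

Let mu_infinite : infinite_set (below mu).
Proof.
by apply: sub_infinite_set theta_infinite => x /= /lt_le_trans; apply.
Qed.

Lemma eventuallyI P Q : eventually P -> eventually Q ->
  eventually (fun i => P i /\ Q i).
Proof.
move=> [k kth kP] [l lth lQ]; exists (Order.max k l); first by rewrite gt_max kth.
by move=> i; rewrite ge_max => /andP[ki li] ith; split; [apply: kP|apply: lQ].
Qed.

Lemma eventuallyW P Q : eventually P -> (forall i, i < theta -> P i -> Q i) ->
  eventually Q.
Proof. by move=> [k kth kP] PQ; exists k => // i ki ith; apply/PQ/kP. Qed.

Lemma eventually_forall c (P : O -> O -> Prop) : c < theta ->
  (forall y, y < c -> eventually (P y)) ->
  eventually (fun i => forall y, y < c -> P y i).
Proof.
move=> cth cP; have [_ _ theta_cof] := theta_regular.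
have /(choice_in c)[k kP] : forall y, below c y -> exists k, k < theta /\
    forall i, k <= i -> i < theta -> P y i.
  by move=> y /cP[k kth kP]; exists k.
have [|l lth kl] := is_cof_bounded wfO (v := k) theta_cof cth.
  by move=> t /kP[].
exists l => // i li ith y yc; apply: (kP y yc).2 => //.
exact/ltW/(lt_le_trans (kl y yc)).
Qed.

Let f_le a b : a <= b -> b < lambda -> eventually (fun i => f a i <= f b i).
Proof.
rewrite le_eqVlt => /orP[/eqP-> _|ab bl].
  have [k kth] := infinite_setN0 theta_infinite; by exists k.
by apply: eventuallyW (f_incr ab bl) _ => i _ /ltW.
Qed.

(** [bstar] is added so that every value of [f] has a candidate above it. *)
Definition candidates (s : O -> O -> O) i :=
  [set z | (exists2 t, t < theta & s i t = z) \/ z = bstar].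

Definition ceil s i y := xget bstar
  [set z | [/\ candidates s i z, y <= z &
            forall z', candidates s i z' -> y <= z' -> z <= z']].

Lemma ceilP s i y : y <= bstar ->
  [/\ candidates s i (ceil s i y), y <= ceil s i y &
      forall z, candidates s i z -> y <= z -> ceil s i y <= z].
Proof.
move=> yb; apply: (xgetPex bstar
  (P := [set z | [/\ candidates s i z, y <= z &
          forall z', candidates s i z' -> y <= z' -> z <= z']])).
have [z [zs yz] z_min] := @wf_min _ _ wfO
  [set z | candidates s i z /\ y <= z] bstar (conj (or_intror erefl) yb).
by exists z; split=> // z' ? ?; apply: z_min.
Qed.

Lemma ceil_homo s i y z : y <= z -> z <= bstar -> ceil s i y <= ceil s i z.
Proof.
move=> yz zb; have [zs zz _] := ceilP s i zb.
have [_ _ y_min] := ceilP s i (le_trans yz zb).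
exact: y_min zs (le_trans yz zz).
Qed.

(** Let [e i] be the least candidate bounding [A]. As [b] has cofinality above [theta], the members
    of [A] below some [c < b] already rule out all smaller candidates. An [f a] dominating them has
    ceiling at least [e i], while every [f x] is eventually below a member of [A], so its ceiling is
    at most [e i]. *)
Lemma ceil_stabilizes_below s b : b < lambda -> S b -> exists2 a, a < b &
  forall c, a <= c -> c < b ->
    eventually (fun i => ceil s i (f c i) = ceil s i (f a i)).
Proof.
move=> bl /S_good[[m b_cof th_m] [A [A_unb A_good]]].
have fb c i : c < b -> i < theta -> f c i <= bstar.
  by move=> cb ith; apply/ltW/f_lt => //; apply: lt_trans bl.
(* The family indexed below the least ordinal is empty; a bound for it is a point of [b], used later
   as a default. *)
have [x0 x0b] : exists x0, x0 < b.
  have [z _ z_min] := @wf_min _ _ wfO setT theta I.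
  have zth : z < theta.
    have [t tth] := infinite_setN0 theta_infinite.
    by apply: le_lt_trans tth; apply: z_min.
  have [|y yb _] := is_cof_bounded wfO (v := id) b_cof (lt_trans zth th_m).
    by move=> t tz; have := z_min t I; rewrite leNgt tz.
  by exists y.
(* [e i] is the least candidate bounding [f x i] for all [x] in [A]. *)
have /(choice_in bstar)[e eP] : forall i, below theta i -> exists z,
    [/\ candidates s i z, z <= bstar, forall x, A x -> x < b -> f x i <= z &
     forall t, t < theta -> s i t < z -> exists x, [/\ A x, x < b & s i t < f x i]].
  move=> i ith.
  have [|z [zs zA] z_min] := @wf_min _ _ wfO [set z | candidates s i z /\
      forall x, A x -> x < b -> f x i <= z] bstar.
    by split=> [|x _ xb]; [right|apply: fb].
  exists z; split=> // [|t tth sz].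
    by apply: z_min; split=> [|x _ xb]; [right|apply: fb].
  apply: contrapT => no_x.
  suff /z_min : candidates s i (s i t) /\ forall x, A x -> x < b -> f x i <= s i t.
    by rewrite leNgt sz.
  split; first by left; exists t.
  by move=> x Ax xb; rewrite leNgt; apply/negP => sx; apply: no_x; exists x.
have /(choice_in bstar)[r rP] : forall i, below theta i -> exists y, y < b /\
    forall t, t < theta -> s i t < e i ->
      exists x, [/\ A x, x < y & s i t < f x i].
  move=> i ith; have [_ _ _ eA] := eP i ith.
  have /(choice_in bstar)[q qP] : forall t, below theta t -> exists x, x < b /\
      (s i t < e i -> A x /\ s i t < f x i).
    move=> t tth; have [/(eA t tth)[x [Ax xb sx]]|_] := ltP (s i t) (e i).
      by exists x.
    by exists x0.
  have [|y yb qy] := is_cof_bounded wfO (v := q) b_cof th_m.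
    by move=> t /qP[].
  exists y; split=> // t tth /(qP t tth).2[Aq sq].
  by exists (q t); split=> //; apply: qy.
have [|c cb rc] := is_cof_bounded wfO (v := r) b_cof th_m.
  by move=> i /rP[].
have [a ab a_good] := A_good c cb.
exists a => // x ax xb.
have [y [Ay yb] xy] := A_unb x xb.
have yl := lt_trans yb bl; have xl := lt_trans xb bl.
apply: eventuallyW (eventuallyI a_good (eventuallyI (f_le xy yl) (f_le ax xl))) _.
move=> i ith [a_ub [fxy fax]].
have [es eb eA e_min] := eP i ith.
apply/le_anti/andP; split; last by apply: ceil_homo => //; apply: fb.
have [_ _ x_min] := ceilP s i (fb x i xb ith).
apply: le_trans (x_min (e i) es (le_trans fxy (eA y Ay yb))) _.
have [[[t tth tE]|-> //] az _] := ceilP s i (fb a i ab ith).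
rewrite -tE leNgt; apply/negP => /((rP i ith).2 t tth)[z [Az zr sz]].
have := a_ub z Az (lt_trans zr (rc i ith)).
by rewrite leNgt => /negP; apply; apply: le_lt_trans sz; rewrite tE.
Qed.

Lemma ceil_stabilizes s : exists2 a, a < lambda &
  forall c, a <= c -> c < lambda ->
    eventually (fun i => ceil s i (f c i) = ceil s i (f a i)).
Proof.
have [|a al aQ] := stationary_pressing_down wfO
    (Q := fun a b => forall c, a <= c -> c < b ->
      eventually (fun i => ceil s i (f c i) = ceil s i (f a i)))
    lambda_succ mu_infinite S_stationary.
  by move=> b Sb; apply: ceil_stabilizes_below => //; apply: S_stationary.1.
exists a => // c ac cl; have [d' cd' d'l] := card_succ_limit lambda_succ mu_infinite cl.
have [b [d'b bl Qab]] := aQ d' d'l.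
exact: Qab ac (lt_le_trans cd' d'b).
Qed.

(** The cardinals listed by [E] are the possible cofinalities above [theta]; as there are fewer than
    [theta] of them, [eventually_forall] treats them all at once. *)
Context (E : O -> O) (c0 : O) (c0_lt : c0 < theta).
Context (E_cardinals : forall k, is_cardinal k -> theta < k -> k < lambda ->
  exists2 y, y < c0 & E y = k).

(* Where [h i] has cofinality at most [theta], lower it by stabilizing ceilings
   in a cofinal set; the other indices split into fewer than [theta] classes by
   cofinality, and on each class a single point of the cofinality works. *)
Lemma eventual_bound_descends h : (forall i, i < theta -> h i <= bstar) ->
  (forall a, a < lambda -> eventually (fun i => f a i < h i)) ->
  exists2 g, eventually (fun i => g i < h i) &
    forall a, a < lambda -> eventually (fun i => f a i <= g i).
Proof.
move=> hb fh.
pose small i := exists u, forall y, y < h i ->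
  exists t, [/\ t < theta, y <= u t & u t < h i].
have /(choice_in id)[s sP] : forall i, small i -> exists u, forall y, y < h i ->
    exists t, [/\ t < theta, y <= u t & u t < h i] by [].
have /(choice_in (theta, id))[KH KHP] : forall i, ~ small i -> exists kH : O * (O -> O),
    [/\ is_cardinal kH.1, theta < kH.1 <= h i,
      forall a b, a <= b -> b < kH.1 -> kH.2 a <= kH.2 b,
      forall y, y < h i -> exists2 a, a < kH.1 & y <= kH.2 a &
      (forall a, a < kH.1 -> kH.2 a < h i) /\
      forall v, (forall t, t < theta -> v t < kH.1) ->
        exists2 a, a < kH.1 & forall t, t < theta -> v t <= a].
  move=> i i_large; have [//|[k [H kH]]] := cofinality_cases wfO (h i) theta_infinite.
  by exists (k, H).
pose K i := (KH i).1; pose H i := (KH i).2.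
(* For each [c], cofinality above [theta] gives one [a < k] for the whole class; as [k < lambda],
   some [a] recurs for unboundedly many [c], hence serves all. The premises sit under the
   existential so that choice yields a total [xi]. *)
have large_bound k : exists a, ~ (forall i, i < theta -> ~ small i -> K i <> k) ->
    k < lambda -> a < k /\ forall c, c < lambda ->
      eventually (fun i => ~ small i -> K i = k -> f c i <= H i a).
  have [no_i|some_i] := pselect (forall i, i < theta -> ~ small i -> K i <> k).
    by exists k.
  have [i0 [i0th i0_large K0]] : exists i, [/\ i < theta, ~ small i & K i = k].
    apply: contrapT => no_i; apply: some_i => i ith i_large Ki.
    by apply: no_i; exists i.
  have [kl|lk] := ltP k lambda; last by exists k => _.
  have [kC /andP[th_k _] _ _ [_ k_reg]] := KHP i0 i0_large.
  rewrite -/(K i0) K0 in kC th_k k_reg.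
  have /(choice_in k)[r rP] : forall c, below lambda c -> exists a, a < k /\
      eventually (fun i => ~ small i -> K i = k -> f c i <= H i a).
    move=> c /fh fch.
    have /(choice_in k)[v vP] : forall i, below theta i -> exists a, a < k /\
        (f c i < h i -> ~ small i -> K i = k -> f c i <= H i a).
      move=> i ith; have [fci|] := pselect (f c i < h i); last first.
        by exists theta.
      have [i_small|i_large] := pselect (small i); first by exists theta.
      have [Ki|nKi] := pselect (K i = k); last by exists theta.
      have [_ _ _ H_cof _] := KHP i i_large.
      have [a aK fa] := H_cof _ fci.
      by exists a; split=> //; rewrite -Ki.
    have [|a ak va] := k_reg v; first by move=> t /vP[].
    exists a; split=> //; apply: eventuallyW fch _ => i ith fci i_large Ki.
    have [_ /(_ fci i_large Ki) fv] := vP i ith.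
    apply: le_trans fv _; have [_ _ H_homo _ _] := KHP i i_large.
    by apply: H_homo; [apply: va|rewrite -/(K i) Ki].
  have [|j jk jP] := card_succ_pigeonhole wfO (v := r) lambda_succ mu_infinite kl.
    by move=> x /rP[].
  exists j => _ _; split=> // c cl; have [x [cx xl xj]] := jP c cl.
  have [_] := rP x xl; rewrite xj => fxH.
  apply: eventuallyW (eventuallyI fxH (f_le cx xl)) _ => i _ [fx fcx] i_large Ki.
  exact: le_trans fcx (fx i_large Ki).
have /choice[xi xiP] := large_bound.
have [a al a_stab] := ceil_stabilizes s.
have K_lt i : i < theta -> ~ small i -> K i < lambda.
  move=> ith i_large; have [_ /andP[_ Kh] _ _ _] := KHP i i_large.
  exact: le_lt_trans (le_trans Kh (hb i ith)) bstar_lt.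
have xi_i i : i < theta -> ~ small i -> xi (K i) < K i /\ forall c, c < lambda ->
    eventually (fun j => ~ small j -> K j = K i -> f c j <= H j (xi (K i))).
  by move=> ith i_large; apply: xiP; [move=> /(_ i ith i_large)|apply: K_lt].
(* At small [i] the ceiling stays below [h i] because [s i] is cofinal there; elsewhere [H i] takes
   values below [h i]. *)
exists (fun i => if pselect (small i) then ceil s i (f a i) else H i (xi (K i))).
  apply: eventuallyW (fh a al) _ => i ith fah; case: pselect => [i_small|i_large].
    have [t [tth ft th]] := sP i i_small _ fah.
    have [_ _ c_min] := ceilP s i (ltW (f_lt al ith)).
    by apply: le_lt_trans th; apply: c_min => //; left; exists t.
  have [_ _ _ _ [H_lt _]] := KHP i i_large.
  exact/H_lt/(xi_i i ith i_large).1.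
move=> c cl.
have large_c : eventually (fun i => forall y, y < c0 ->
    ~ small i -> K i = E y -> f c i <= H i (xi (E y))).
  apply: eventually_forall => // y yc0.
  have [no_i|some_i] := pselect (forall i, i < theta -> ~ small i -> K i <> E y).
    have [k kth] := infinite_setN0 theta_infinite; exists k => // i _ ith.
    by move=> i_large Ki; case: (no_i i ith i_large).
  have [El|lE] := ltP (E y) lambda; first exact: (xiP _ some_i El).2.
  have [k kth] := infinite_setN0 theta_infinite; exists k => // i _ ith i_large Ki.
  by have := K_lt i ith i_large; rewrite Ki ltNge lE.
pose b := Order.max a c; have bl : b < lambda by rewrite gt_max al.
have ab : a <= b by rewrite le_max lexx.
have cb : c <= b by rewrite le_max lexx orbT.
apply: eventuallyW (eventuallyI large_c (eventuallyI (a_stab b ab bl) (f_le cb bl))) _.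
move=> i ith [fH [fa fcb]]; case: pselect => [i_small|i_large].
  rewrite -fa; apply: le_trans fcb _.
  by have [] := ceilP s i (ltW (f_lt bl ith)).
have [kC /andP[th_k _] _ _ _] := KHP i i_large.
have [y yc0 Ey] := E_cardinals kC th_k (K_lt i ith i_large).
by have := fH y yc0 i_large (esym Ey); rewrite Ey.
Qed.

(** Taking [tau] to be the successor of [theta], each stage has at most [theta] predecessors, and
    some threshold below [theta] is shared by unboundedly many stages; [tau < lambda] gives one [c]
    past the stabilization points of all stages. *)
Lemma no_bounded_increasing_sequence tau :
  is_card_succ theta tau -> tau < lambda -> False.
Proof.
move=> tau_succ tau_lt.
have /(choice_in id)[e eP] : forall z, below tau z -> exists e : O -> O,
    forall x, x < z -> exists2 t, t < theta & e t = x.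
  move=> z /(card_succ_card_le wfO tau_succ)/(card_le_inj_into theta)[u uth u_inj].
  have /(choice_in theta)[e eP] : forall t, (u @` below z) t ->
      exists x, x < z /\ u x = t by move=> t [x xz <-]; exists x.
  exists e => x xz; exists (u x); first exact: uth.
  have [ez ue] := eP (u x) (ex_intro2 _ _ x xz erefl).
  exact: u_inj.
(* The candidates at stage [z] are the earlier bounds, listed along [e z]; [bstar] fills the indices
   that list none. *)
pose s z (G : O -> O -> O) i t := if e z t < z then G (e z t) i else bstar.
(* The pair [ha] holds the stabilized ceiling of the [f c] and the point from which it is stable;
   [g] is an eventual bound strictly below that ceiling. *)
pose stage z G g := z < tau -> exists ha : (O -> O) * O, ha.2 < lambda /\
  forall c, ha.2 <= c -> c < lambda -> eventually (fun i =>
    [/\ f c i <= g i, g i < ha.1 i & ceil (s z G) i (f c i) = ha.1 i]).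
have [F FP] : exists F, forall z, stage z F (F z).
  apply: (wf_choice_rec id wfO) => [z F G g FG|z G _].
    suff -> : stage z F g = stage z G g by [].
    suff sE : s z F = s z G by rewrite /stage sE.
    by apply/funext => i; apply/funext => t; rewrite /s; case: ifP => // /FG->.
  have [a al a_stab] := ceil_stabilizes (s z G).
  pose h i := ceil (s z G) i (f a i).
  have [i ith|c cl|g gh fg] := @eventual_bound_descends h.
  - have [_ _] := ceilP (s z G) i (ltW (f_lt al ith)); apply; first by right.
    exact/ltW/f_lt.
  - have acl : Order.max a c < lambda by rewrite gt_max al.
    (* Stabilization alone gives a weak bound on [f c]; a later [b], with [f c < f b] eventually,
       makes it strict. *)
    have [b acb bl] := card_succ_limit lambda_succ mu_infinite acl.
    move: acb; rewrite gt_max => /andP[ab cb].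
    apply: eventuallyW (eventuallyI (a_stab b (ltW ab) bl) (f_incr cb bl)) _.
    move=> i ith [hE fcb]; rewrite /h -hE; apply: lt_le_trans fcb _.
    by have [] := ceilP (s z G) i (ltW (f_lt bl ith)).
  exists g => _; exists (h, a); split=> // c ac cl /=.
  apply: eventuallyW (eventuallyI (fg c cl) (eventuallyI gh (a_stab c ac cl))) _.
  by move=> i _ [? [? ?]].
have /(choice_in (id, theta))[ha haP] := FP.
have [|c cl hac] := card_succ_bounded wfO (v := fun z => (ha z).2)
    lambda_succ mu_infinite tau_lt.
  by move=> z /haP[].
have /(choice_in theta)[k kP] : forall z, below tau z -> exists k, k < theta /\
    forall i, k <= i -> i < theta -> [/\ f c i <= F z i, F z i < (ha z).1 i &
      ceil (s z F) i (f c i) = (ha z).1 i].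
  move=> z zt; have [_ /(_ c (hac z zt) cl)[k kth kP]] := haP z zt.
  by exists k.
have [_ th_tau _] := tau_succ.
have [|j jth jP] := card_succ_pigeonhole wfO (v := k) tau_succ theta_infinite th_tau.
  by move=> z /kP[].
(* On the unbounded set of stages [z] with [k z = j] the values [h_z j] strictly
   decrease. *)
pose V := [set y | exists z, [/\ z < tau, k z = j & (ha z).1 j = y]].
have [z0 [_ z0t z0j]] := jP theta th_tau.
have [_ [z [zt zj <-]] z_min] := @wf_min _ _ wfO V _
  (ex_intro _ z0 (And3 z0t z0j erefl)).
have [z' zz' z't] := card_succ_limit tau_succ theta_infinite zt.
have [w [z'w wt wj]] := jP z' z't.
have zw := lt_le_trans zz' z'w.
have [_ /(_ j)] := kP z zt; rewrite zj => /(_ (lexx j) jth)[fz zh _].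
have [_ /(_ j)] := kP w wt; rewrite wj => /(_ (lexx j) jth)[_ _ wE].
have := z_min _ (ex_intro _ w (And3 wt wj erefl)).
rewrite leNgt => /negP; apply; apply: le_lt_trans zh; rewrite -wE.
(* [F z j] is a candidate at the later stage [w] and bounds [f c j], so the ceiling of stage [w] at
   [j] is at most [F z j], which is below that of stage [z]. *)
have [_ _ w_min] := ceilP (s w F) j (ltW (f_lt cl jth)).
apply: w_min => //; left; have [t tth et] := eP w wt z zw.
by exists t => //; rewrite /s et zw.
Qed.

End IncreasingSequence.

(** * The cardinals [theta^{+x}] *)

Section CardinalPlus.
Context {d : Order.disp_t} {O : orderType d}.
Implicit Types (a b c k m n t x y z : O) (A B X : set O) (v w : O -> O).

Lemma is_zero_not_lt x y : is_zero x -> ~ y < x.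
Proof. by move=> /(_ y); rewrite leNgt => /negP. Qed.

Lemma is_succ_not_limit x y : is_succ x y -> ~ is_limit y.
Proof.
by move=> [xy y_min] [_ /(_ x xy)[z xz]]; rewrite ltNge y_min.
Qed.

Lemma is_succ_inj x x' y : is_succ x y -> is_succ x' y -> x = x'.
Proof.
move=> [xy y_min] [x'y y_min']; have [xx'|x'x|//] := ltgtP x x'.
  by have := y_min x' xx'; rewrite leNgt x'y.
by have := y_min' x x'x; rewrite leNgt xy.
Qed.

Lemma card_plus_uniq k x m n : card_plus k x m -> card_plus k x n -> m = n.
Proof.
move=> kxm; elim: kxm n => {x m} [x x0|x y m n xy _ IH mn|x f m xl kf IH mS] p.
- move E : x => x' kxp; case: kxp E x0 => {x' p} [//|z y p m zy _ _|z f m zl _ _] -> x0.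
  + by case: (is_zero_not_lt x0 zy.1).
  + by case: zl => -[y /(is_zero_not_lt x0)].
- move E : y => y' kyp; case: kyp E xy => {y' p}
    [z z0|z y' m' p zy' kzm m'p|z f p zl _ _] -> xy.
  + by case: (is_zero_not_lt z0 xy.1).
  + rewrite -(is_succ_inj xy zy') in kzm; rewrite -(IH _ kzm) in m'p.
    case: mn m'p => nC mn n_min [pC mp p_min].
    by apply/le_anti; rewrite n_min // p_min.
  + by case: (is_succ_not_limit xy).
- move E : x => x' kxp; case: kxp E xl => {x' p}
    [z z0|z y' m' p zy' kzm m'p|z g p zl kg pS] xE xl.
  + by case: xl => -[y]; rewrite xE => /(is_zero_not_lt z0).
  + by rewrite xE in xl; case: (is_succ_not_limit zy').
  + rewrite -xE in kg pS.
    have fg : f @` below x = g @` below x.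
      by apply: eq_imagel => y yx; apply: IH yx _ (kg y yx).
    rewrite -fg in pS; case: mS pS => ubm m_min [ubp p_min].
    by apply/le_anti; rewrite m_min // p_min.
Qed.

(** No cardinal is skipped: none lies strictly between [m] and its successor, and one below a
    supremum is below some [f y]. *)
Lemma card_plus_cardinals k x m n : card_plus k x m ->
  is_cardinal n -> k <= n -> n < m -> exists2 y, y < x & card_plus k y n.
Proof.
move=> kxm nC kn; elim: kxm => {x m}
  [x _|x y m p [xy _] kxm IH [_ mp p_min]|x f m xl kf IH [_ m_min]].
- by rewrite ltNge kn.
- move=> np; have [nm|mn|->] := ltgtP n m; last by exists x.
    by have [z zx kzn] := IH nm; exists z => //; apply: lt_trans xy.
  by have := p_min n nC mn; rewrite leNgt np.
- move=> nm; have [y yx ny] : exists2 y, y < x & n < f y.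
    apply: contrapT => no_y; have : m <= n.
      apply: m_min => _ [y yx <-]; rewrite leNgt; apply/negP => ny.
      by apply: no_y; exists y.
    by rewrite leNgt nm.
  by have [z zy kzn] := IH y yx ny; exists z => //; apply: lt_trans yx.
Qed.

Lemma card_plus_ge k x m : card_plus k x m ->
  k <= m /\ forall y, y < x -> exists n, [/\ is_cardinal n, k < n & n <= m].
Proof.
elim=> {x m} [x x0|x y m p _ _ [km _] [pC mp _]|x f m [[z zx] x_lim] kf IH [ubm _]].
- by split=> // y /(is_zero_not_lt x0).
- have kp := le_lt_trans km mp; split; first exact: ltW.
  by exists p.
- have fm y : y < x -> f y <= m by move=> yx; apply: ubm; exists y.
  split; first exact: le_trans (IH z zx).1 (fm z zx).
  (* A second index [y] above [z] is nonzero, so its induction hypothesis supplies a cardinal above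
     [k]. *)
  move=> _ _; have [y zy yx] := x_lim z zx.
  have [n [nC kn nf]] := (IH y yx).2 z zy.
  by exists n; split=> //; apply: le_trans (fm y yx).
Qed.

End CardinalPlus.

(** * Order types of the entries of a normal transitive matrix *)

Theorem theorem6p11 (d : Order.disp_t) (O : orderType d)
    (wfO : well_founded (fun x y : O => x < y))
    (theta eta one eta1 lambda : O)
    (theta_regular : is_regular theta)
    (is_one_one : is_one one)
    (one_le_eta : one <= eta)
    (eta_lt_theta : eta < theta)
    (eta1_succ : is_succ eta eta1)
    (lambda_eq : card_plus theta eta1 lambda)
    (D : O -> O -> set O)
    (D_matrix : covering_matrix theta lambda D)
    (D_transitive : matrix_transitive theta lambda D)
    (D_good : is_stationary (good_points theta lambda D) lambda) :
  ~ matrix_normal theta lambda D.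
Proof.
move=> [bstar bstar_lt D_otp].
have [theta_card theta_inf _] := theta_regular.
have [mu theta_mu lambda_succ] :
    exists2 mu, card_plus theta eta mu & is_card_succ mu lambda.
  move: eta1_succ; case: lambda_eq => [x x0|x y m n xy txm mn|x f m xl _ _] s.
  - by case: (is_zero_not_lt x0 s.1).
  - by exists m; rewrite ?(is_succ_inj s xy).
  - by case: (is_succ_not_limit s).
have [theta_le_mu mu_gt] := card_plus_ge theta_mu.
have [_ mu_lt _] := lambda_succ.
(* Since [one <= eta], some cardinal above [theta] is at most [mu]; the least one is the successor
   of [theta]. *)
have [tau tau_succ tau_lt] : exists2 tau, is_card_succ theta tau & tau < lambda.
  have [z _ [z_one _]] := is_one_one.
  have [n [nC th_n n_mu]] := mu_gt z (lt_le_trans z_one one_le_eta).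
  have [tau [tauC th_tau] tau_min] := @wf_min _ _ wfO
    [set n | is_cardinal n /\ theta < n] n (conj nC th_n).
  exists tau; first by split=> // n' ? ?; apply: tau_min.
  by apply: le_lt_trans mu_lt; apply: le_trans n_mu; apply: tau_min.
have eta1_lt : eta1 < theta.
  have [y ey yth] := infinite_cardinal_limit theta_card theta_inf eta_lt_theta.
  by apply: le_lt_trans yth; apply: eta1_succ.2.
(* [E y] is [theta^{+y}], with [theta] as the default where this has no value in [O]. *)
have /choice[E EP] : forall y, exists k, forall n, card_plus theta y n -> k = n.
  move=> y; have [[k tk]|no_k] := pselect (exists k, card_plus theta y k).
    by exists k => n; apply: card_plus_uniq.
  by exists theta => n tn; case: no_k; exists n.
have [D_cover D_incr _] := D_matrix.
have /(choice_in theta)[otp otpP] : forall p : O * O, p.1 < lambda /\ p.2 < theta ->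
    exists a, is_otp (D p.2 p.1) a /\ a < bstar.
  by move=> [c i] [cl ith]; have [a] := D_otp i c ith cl; exists a.
(* By transitivity [D i a] is contained in [D i b], which also contains [a], a point above all of
   [D i a]. *)
have otp_lt i a b : i < theta -> b < lambda -> D i b a -> otp (a, i) < otp (b, i).
  move=> ith bl Dba; have D_below c : c < lambda -> D i c `<=` below c.
    by move=> cl x Dx; rewrite (D_cover c cl); exists i.
  have al : a < lambda := lt_trans (D_below b bl a Dba) bl.
  have [otp_a _] := otpP (a, i) (conj al ith).
  have [otp_b _] := otpP (b, i) (conj bl ith).
  by apply: (is_otp_lt wfO otp_a otp_b _ _ Dba); [apply: D_transitive|apply: D_below].
have D_le i j b : i <= j -> j < theta -> b < lambda -> D i b `<=` D j b.
  by rewrite le_eqVlt => /orP[/eqP-> _ _ x|] //; apply: D_incr.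
apply: (@no_bounded_increasing_sequence _ _ wfO theta mu lambda bstar
  (fun a i => otp (a, i)) (good_points theta lambda D) theta_regular theta_le_mu
  lambda_succ bstar_lt _ _ D_good _ E eta1 eta1_lt _ tau tau_succ tau_lt).
- by move=> a i al ith; have [] := otpP (a, i) (conj al ith).
(* Covering puts [a] in some [D i b], hence in [D j b] for all later [j]. *)
- move=> a b ab bl; have : below b a by [].
  rewrite (D_cover b bl) => -[i ith Dba]; exists i => // j ij jth.
  by apply: otp_lt => //; apply: D_le Dba.
- move=> b [bl b_cof [A [Ab A_unb A_good]]]; split=> //; exists A; split=> // c cb.
  have [a [i [ab ith AD]]] := A_good c cb; exists a => //; exists i => // j ij jth x Ax xc.
  have al := lt_trans ab bl.
  by apply/ltW/otp_lt => //; apply: (D_le i j) => //; apply: AD.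
- move=> k kC th_k kl; have [y yeta ty] := card_plus_cardinals lambda_eq kC (ltW th_k) kl.
  by exists y => //; apply: EP.
Qed.
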